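(* Assume that $\mu_1=\mu_2\in\mathcal P_{ac}(\mathbb R^d)$. Then for all $m,n\ge1$ the distribution of the rank Hotelling statistic $T^{\nu,J}_{m,n}$ is universal, that is, it does not depend on the common distribution $\mu_1=\mu_2$.
   Context: $\mathcal P_{ac}(\mathbb R^d)$ is the set of Lebesgue absolutely continuous probability measures on $\mathbb R^d$. $X_1,\dots,X_m$ are i.i.d. $\mu_1$ and $Y_1,\dots,Y_n$ are i.i.d. $\mu_2$, the two samples being independent; $N=m+n$ and $Z_1,\dots,Z_N$ enumerates the pooled sample. $\{h_1^d,\dots,h_N^d\}\subset\mathbb R^d$ is a fixed set of $N$ vectors. Empirical ranks: $\widehat\sigma\in\arg\min_{\sigma\in S_N}\sum_{i=1}^N\|Z_i-h^d_{\sigma_i}\|^2$, where $S_N$ is the set of permutations of $\{1,\dots,N\}$, and $\widehat R_{m,n}(Z_i):=h^d_{\widehat\sigma_i}$. $\nu\in\mathcal P_{ac}(\mathbb R^d)$ is a fixed reference distribution and $J:\mathbb R^d\to\mathbb R^d$ a score function, i.e. an injective function continuous Lebesgue a.e. The effective reference distribution (ERD) $J\#\nu$ is assumed to have a finite, positive definite covariance matrix $\Sigma_{\mathrm{ERD}}$. The rank Hotelling $T^2$ statistic is $$T^{\nu,J}_{m,n}:=\frac{mn}{m+n}\,\Delta^{\top}\Sigma_{\mathrm{ERD}}^{-1}\Delta,\qquad \Delta:=\frac1m\sum_{i=1}^mJ(\widehat R_{m,n}(X_i))-\frac1n\sum_{j=1}^nJ(\widehat R_{m,n}(Y_j)).$$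 *)

(* Defs.v *)
From HB Require Import structures.
From mathcomp Require Import all_boot all_order all_algebra all_fingroup.
From mathcomp Require Import all_classical all_reals all_analysis.

Set Implicit Arguments.
Unset Strict Implicit.
Unset Printing Implicit Defensive.

Import Order.TTheory GRing.Theory Num.Theory.
Import numFieldNormedType.Exports.

Local Open Scope classical_set_scope.
Local Open Scope ring_scope.

(* R^d is 'rV[R]_d.  Its topology is the product topology of the library; its
   sigma-algebra is generated by the coordinates (as the library does for
   tuples), which is the Borel sigma-algebra since R is second countable. *)
Section row_measurable.
Context (R : realType) (d : nat).

Definition row_coord (i : 'I_d) (x : 'rV[R]_d) : R := x ord0 i.

Let row_measurable : set (set 'rV[R]_d) := g_sigma_preimage row_coord.

Let row_measurable0 : row_measurable set0.
Proof. exact: sigma_algebra0. Qed.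

Let row_measurableC A : row_measurable A -> row_measurable (~` A).
Proof. exact: sigma_algebraC. Qed.

Let row_measurable_bigcup (F : (set 'rV[R]_d)^nat) :
  (forall i, row_measurable (F i)) -> row_measurable (\bigcup_i (F i)).
Proof. exact: sigma_algebra_bigcup. Qed.

HB.instance Definition _ := @isMeasurable.Build default_measure_display
  'rV[R]_d row_measurable row_measurable0 row_measurableC row_measurable_bigcup.

End row_measurable.

Section row_cons.
Context (R : realType).

Lemma measurable_row_coord d (i : 'I_d) :
  measurable_fun [set: 'rV[R]_d] (@row_coord R d i).
Proof.
move=> _ Y mY; rewrite setTI; apply: sub_sigma_algebra => /=.
rewrite -bigcup_seq/=; exists i => /=; first by rewrite mem_index_enum.
by exists Y => //; rewrite setTI.
Qed.

Lemma measurable_fun_row d d' (T : measurableType d') (f : T -> 'rV[R]_d) :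
  (forall i, measurable_fun setT (fun t => row_coord i (f t))) ->
  measurable_fun setT f.
Proof.
move=> mf; apply: (measurability (\big[setU/set0]_(i < d)
  preimage_set_system setT (@row_coord R d i) measurable)) => //.
move=> _ [B + <-]; rewrite -bigcup_seq => -[i /= _ [C mC <-]].
by rewrite setTI -comp_preimage; have := mf i measurableT C mC.
Qed.

Definition row_cons d (p : measurableTypeR R * 'rV[R]_d) : 'rV[R]_d.+1 :=
  \row_j oapp (p.2 ord0) p.1 (unlift ord0 j).

Definition row_uncons d (x : 'rV[R]_d.+1) : measurableTypeR R * 'rV[R]_d :=
  (x ord0 ord0, \row_j x ord0 (lift ord0 j)).

Lemma row_consK d : cancel (@row_cons d) (@row_uncons d).
Proof.
case=> a v; rewrite /row_uncons/row_cons/= !mxE unlift_none/=; congr pair.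
by apply/rowP => j; rewrite !mxE liftK.
Qed.

Lemma measurable_row_cons d : measurable_fun setT (@row_cons d).
Proof.
apply: measurable_fun_row => i; rewrite /row_coord /row_cons.
under eq_fun do rewrite mxE.
case: (unliftP ord0 i) => [j|] _ /=; last exact: measurable_fst.
exact: (measurableT_comp (@measurable_row_coord d j) measurable_snd).
Qed.

Lemma measurable_row_uncons d : measurable_fun setT (@row_uncons d).
Proof.
apply: measurable_fun_pair; first exact: measurable_row_coord.
apply: measurable_fun_row => i; rewrite /row_coord /row_uncons /=.
under eq_fun do rewrite mxE.
exact: measurable_row_coord.
Qed.

End row_cons.

Section lebesgue_row.
Context (R : realType).

Section step.
Context (d : nat) (mu : {sigma_finite_measure set 'rV[R]_d -> \bar R}).

Definition lebesgue_row_step : set 'rV[R]_d.+1 -> \bar R :=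
  pushforward ((@lebesgue_measure R) \x mu)%E (@row_cons R d).

Let lebesgue_row_step0 : lebesgue_row_step set0 = 0%E.
Proof. by rewrite /lebesgue_row_step /pushforward preimage_set0 measure0. Qed.

Let lebesgue_row_step_ge0 A : (0 <= lebesgue_row_step A)%E.
Proof. exact: (measure_ge0 ((@lebesgue_measure R) \x mu)%E). Qed.

Let lebesgue_row_step_sigma_additive : semi_sigma_additive lebesgue_row_step.
Proof.
move=> F mF tF mUF; rewrite /lebesgue_row_step /pushforward preimage_bigcup.
apply: measure_semi_sigma_additive.
- by move=> n; rewrite -[X in measurable X]setTI; exact: measurable_row_cons.
- apply/trivIsetP => i j _ _ ij; rewrite -preimage_setI.
  by move/trivIsetP : tF => /(_ _ _ _ _ ij) -> //; rewrite preimage_set0.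
- rewrite -preimage_bigcup -[X in measurable X]setTI.
  exact: measurable_row_cons.
Qed.

HB.instance Definition _ := isMeasure.Build _ _ _ lebesgue_row_step
  lebesgue_row_step0 lebesgue_row_step_ge0 lebesgue_row_step_sigma_additive.

Let lebesgue_row_step_sigma_finite : sigma_finite setT lebesgue_row_step.
Proof.
have [F FT mF] : sigma_finite setT ((@lebesgue_measure R) \x mu)%E.
  have /sigma_finiteP[F [TF ndF Foo]] := sigma_finiteT (@lebesgue_measure R).
  have /sigma_finiteP[G [TG ndG Goo]] := sigma_finiteT mu.
  exists (fun n => F n `*` G n).
    rewrite -setXTT TF TG predeqE => -[x y]; split.
      move=> [/= [n _ Fnx] [k _ Gky]]; exists (maxn n k) => //; split.
      - by move: x Fnx; exact/subsetPset/ndF/leq_maxl.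
      - by move: y Gky; exact/subsetPset/ndG/leq_maxr.
    by move=> [n _ []/= ? ?]; split; exists n.
  move=> k; have [? ?] := Foo k; have [? ?] := Goo k.
  split; first exact: measurableX.
  by rewrite product_measure1E// lte_mul_pinfty// ge0_fin_numE.
exists (fun n => @row_uncons R d @^-1` F n).
  by rewrite -preimage_bigcup -FT preimage_setT.
move=> n; have [mFn Fnoo] := mF n; split.
  by rewrite -[X in measurable X]setTI; exact: measurable_row_uncons.
rewrite /lebesgue_row_step /pushforward -comp_preimage.
by rewrite (_ : _ \o _ = id) //; apply/funext => p /=; rewrite row_consK.
Qed.

HB.instance Definition _ := Measure_isSigmaFinite.Build _ _ _
  lebesgue_row_step lebesgue_row_step_sigma_finite.

End step.

Fixpoint lebesgue_row (d : nat) :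
    {sigma_finite_measure set 'rV[R]_d -> \bar R} :=
  match d with
  | 0 => \d_(0 : 'rV[R]_0)
  | d'.+1 => lebesgue_row_step (lebesgue_row d')
  end.

End lebesgue_row.

Section covariance_matrix.
Context (R : realType) (d : nat).
Local Open Scope ereal_scope.

(* J # nu.  J need not be Borel: being continuous Lebesgue-a.e., it is only
   measurable for the completion of nu, so nu is first extended to its outer
   measure nu^*, which is the completion of nu on nu^*-measurable sets and
   coincides with nu on Borel sets. *)
Definition effective_reference (nu : probability 'rV[R]_d R)
    (J : 'rV[R]_d -> 'rV[R]_d) : set 'rV[R]_d -> \bar R :=
  pushforward (nu^*)%mu J.

(* The definitions below are for laws given as bare set functions because
   effective_reference carries no measure structure without a proof that J is
   measurable for the completion. *)
Implicit Type law : set 'rV[R]_d -> \bar R.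

Definition finite_second_moments law : Prop :=
  forall i, \int[law]_x (x ord0 i ^+ 2)%:E < +oo.

Definition mean law (i : 'I_d) : R := fine (\int[law]_x (x ord0 i)%:E).

Definition covariance_matrix law : 'M[R]_d :=
  \matrix_(i, j)
    fine (\int[law]_x ((x ord0 i - mean law i) * (x ord0 j - mean law j))%:E).

Definition positive_definite (A : 'M[R]_d) : Prop :=
  A^T%R = A /\ forall v : 'rV[R]_d, v != 0%R -> (0 < (v *m A *m v^T) ord0 ord0)%R.

End covariance_matrix.

Section sampling.
Context (R : realType) dT (T : measurableType dT) dE (E : measurableType dE).
Variable P : probability T R.
Local Open Scope ereal_scope.

Definition mutually_independent (I : finType) (X : I -> T -> E) : Prop :=
  forall (K : {set I}) (A : I -> set E), (forall i, measurable (A i)) ->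
    P (\bigcap_(i in [set i | i \in K]) (X i @^-1` A i)) =
    \prod_(i in K) P (X i @^-1` A i).

Definition iid_sample m (X : 'I_m -> {RV P >-> E}) (mu : probability E R) :
    Prop :=
  (forall i A, measurable A -> distribution P (X i) A = mu A) /\
  mutually_independent (fun i => X i : T -> E).

Definition independent_samples m n (X : 'I_m -> {RV P >-> E})
    (Y : 'I_n -> {RV P >-> E}) : Prop :=
  forall F G, g_sigma_preimage (fun i => X i : T -> E) F ->
    g_sigma_preimage (fun j => Y j : T -> E) G ->
    P (F `&` G) = P F * P G.

Definition two_sample_model m n (X : 'I_m -> {RV P >-> E})
    (Y : 'I_n -> {RV P >-> E}) (mu1 mu2 : probability E R) : Prop :=
  [/\ iid_sample X mu1, iid_sample Y mu2 & independent_samples X Y].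

End sampling.

Section rank_hotelling.
Context (R : realType) (d m n : nat).
Implicit Types (h z : 'I_(m + n) -> 'rV[R]_d) (s : 'S_(m + n)).

(* The library norm on 'rV[R]_d is the sup norm, hence this definition. *)
Definition euclidean_sqnorm (x : 'rV[R]_d) : R := \sum_(i < d) x ord0 i ^+ 2.

Definition pooled (x : 'I_m -> 'rV[R]_d) (y : 'I_n -> 'rV[R]_d)
    (i : 'I_(m + n)) : 'rV[R]_d :=
  match fintype.split i with inl j => x j | inr k => y k end.

Definition assignment_cost h z s : R :=
  \sum_(i < m + n) euclidean_sqnorm (z i - h (s i)).

Definition optimal_assignment h z s : Prop :=
  forall t : 'S_(m + n), assignment_cost h z s <= assignment_cost h z t.

Definition empirical_rank h s (i : 'I_(m + n)) : 'rV[R]_d := h (s i).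

(* The observation X_i has index lshift n i in the pooled sample, and Y_j has
   index rshift m j. *)
Definition rank_mean_diff (J : 'rV[R]_d -> 'rV[R]_d) h s : 'rV[R]_d :=
  m%:R^-1 *: (\sum_(i < m) J (empirical_rank h s (lshift n i))) -
  n%:R^-1 *: (\sum_(j < n) J (empirical_rank h s (rshift m j))).

Definition rank_hotelling (nu : probability 'rV[R]_d R)
    (J : 'rV[R]_d -> 'rV[R]_d) h s : R :=
  let D := rank_mean_diff J h s in
  (m * n)%:R / (m + n)%:R *
    (D *m invmx (covariance_matrix (effective_reference nu J)) *m D^T)
      ord0 ord0.

End rank_hotelling.

(* Main.v *)
(* Two permutations s <> t have the same assignment cost only if the pooled
   sample Z satisfies sum_i <h_{s i} - h_{t i}, Z_i> = 0; some coefficient is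
   nonzero because h is injective, and as mu charges no hyperplane this event is
   null.  Hence almost surely there is a unique optimal permutation.  Permuting
   the sample permutes the optimal assignments, and the law of Z is
   exchangeable, so every permutation is the optimal one with probability 1/N!.
   The statistic is a fixed function of the optimal permutation, so its law is
   the image of the uniform law on S_N. *)
Require Import Defs.
From HB Require Import structures.
From mathcomp Require Import all_boot all_order all_algebra all_fingroup.
From mathcomp Require Import all_classical all_reals all_analysis.
From mathcomp Require Import measurable_realfun.

Set Implicit Arguments.
Unset Strict Implicit.
Unset Printing Implicit Defensive.

Import Order.TTheory GRing.Theory Num.Theory.
Import numFieldNormedType.Exports.

Local Open Scope classical_set_scope.
Local Open Scope ring_scope.

(** * Hyperplanes are Lebesgue null *)

Lemma measurable_hyperplane (R : realType) d (v : 'rV[R]_d) (c : R) :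
  measurable [set x : 'rV[R]_d | \sum_i v ord0 i * x ord0 i = c].
Proof.
have mf : measurable_fun setT (fun x : 'rV[R]_d => \sum_i v ord0 i * x ord0 i).
  apply: measurable_sum => i; apply: measurable_funM; first exact: measurable_cst.
  exact: measurable_row_coord.
by rewrite -[X in measurable X]setTI; exact: (mf measurableT [set c]).
Qed.

(** Induction on [d], splitting off the first coordinate. If the tail [v'] of the normal vector is
    nonzero, each section at a fixed first coordinate is a hyperplane one dimension lower, hence
    null, and Fubini concludes. Otherwise the equation pins the first coordinate to one value, and
    points are null in R. *)
Lemma lebesgue_row_hyperplane (R : realType) d (v : 'rV[R]_d) (c : R) :
  v != 0 ->
  lebesgue_row R d [set x | \sum_i v ord0 i * x ord0 i = c] = 0%E.
Proof.
elim: d v c => [|d IHd] v c v0; first by rewrite thinmx0 eqxx in v0.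
pose v' : 'rV[R]_d := \row_j v ord0 (lift ord0 j).
have sumE (p : R * 'rV[R]_d) : \sum_i v ord0 i * row_cons p ord0 i =
    v ord0 ord0 * p.1 + \sum_i v' ord0 i * p.2 ord0 i.
  rewrite big_ord_recl /row_cons !mxE unlift_none/=; congr (_ + _).
  by apply: eq_bigr => i _; rewrite !mxE liftK.
rewrite [LHS]/(lebesgue_row_step _ _) /lebesgue_row_step /pushforward.
have [v'0|v'0] := eqVneq v' 0; last first.
  rewrite /product_measure1 integral0_eq// => a _ /=.
  rewrite -[RHS](IHd v' (c - v ord0 ord0 * a) v'0); congr (lebesgue_row R d _).
  rewrite xsectionE; apply/seteqP; split => y /=; rewrite sumE/=.
    by move=> <-; rewrite addrAC subrr add0r.
  by move=> ->; rewrite addrC subrK.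
have v00 : v ord0 ord0 != 0.
  apply: contraNneq v0 => v00; apply/eqP/rowP => j; rewrite mxE.
  case: (unliftP ord0 j) => [k|] ->; last exact: v00.
  by move/rowP: v'0 => /(_ k); rewrite !mxE.
rewrite (_ : _ @^-1` _ = [set c / v ord0 ord0] `*` setT); last first.
  apply/seteqP; split => -[a y] /=; rewrite sumE/= v'0.
    under eq_bigr do rewrite mxE mul0r.
    by rewrite big1// addr0 => <-; rewrite mulrAC divff// mul1r.
  move=> [-> _]; under eq_bigr do rewrite mxE mul0r.
  by rewrite big1// addr0 mulrC divfK.
(* The second factor may have infinite measure; the convention [0 * +oo = 0] settles this case. *)
by rewrite product_measure1E//= lebesgue_measure_set1 mul0e.
Qed.

(** * Joint law of an i.i.d. sample *)

(** Rectangles are stable under intersection, generate the sigma-algebra of tuples and include the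
    whole space, whose mass is finite; the uniqueness theorem for measures on a pi-system
    applies. *)
Lemma tuple_measure_unique (R : realType) dE (E : measurableType dE) N
    (m1 m2 : {measure set (N.-tuple E) -> \bar R}) :
  (m1 setT < +oo)%E ->
  (forall A : 'I_N -> set E, (forall i, measurable (A i)) ->
    m1 [set t | forall i, A i (tnth t i)] =
    m2 [set t | forall i, A i (tnth t i)]) ->
  forall B, measurable B -> m1 B = m2 B.
Proof.
move=> m1oo m12 B mB.
pose rect (A : 'I_N -> set E) := [set t : N.-tuple E | forall i, A i (tnth t i)].
have rectE A : rect A = \bigcap_(i in setT) ((@tnth _ E)^~ i @^-1` A i).
  by apply/seteqP; split => t /= At i => [_|]; exact: At.
pose G := [set B | exists2 A, (forall i, measurable (A i)) & B = rect A].
have GT : G setT.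
  exists (fun=> setT) => //; rewrite /rect/=.
  by apply/seteqP; split.
apply: (measure_unique G (fun=> setT)) => //.
- rewrite eqEsubset; split.
    apply: smallest_sub; first exact: smallest_sigma_algebra.
    rewrite -bigcup_seq => _ [i _ [C mC <-]].
    (* A one-coordinate cylinder is the rectangle whose other sides are the whole space. *)
    apply: sub_sigma_algebra; exists (fun j => if j == i then C else setT).
      by move=> j; case: ifP.
    rewrite setTI /rect; apply/seteqP; split => t /= At; last first.
      by move: (At i); rewrite eqxx.
    by move=> j; case: eqP => // ->.
  apply: smallest_sub; first exact: sigma_algebra_measurable.
  move=> _ [A mA ->]; rewrite rectE; apply: fin_bigcap_measurable => // i _.
  by rewrite -[X in measurable X]setTI; exact: measurable_tnth.
- move=> _ _ [A mA ->] [C mC ->]; exists (fun i => A i `&` C i).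
    by move=> i; exact: measurableI.
  by apply/seteqP; split => [t /= [At Ct] i|t /= ACt]; [|split => i; have [] := ACt i].
- by rewrite bigcup_const.
- by move=> _ [A mA ->]; exact: m12.
Qed.

Section joint_law.
Context (R : realType) dE (E : measurableType dE).

Definition sample_tuple dT (T : measurableType dT) N
  (Z : 'I_N -> {mfun T >-> E}) (w : T) : N.-tuple E := [tuple Z i w | i < N].

Lemma measurable_sample_tuple dT (T : measurableType dT) N
  (Z : 'I_N -> {mfun T >-> E}) : measurable_fun setT (sample_tuple Z).
Proof.
apply/measurable_fun_tnthP => i.
rewrite (_ : _ \o _ = Z i); first exact: measurable_funP.
by apply/funext => w; rewrite /= tnth_mktuple.
Qed.

HB.instance Definition _ dT (T : measurableType dT) N
    (Z : 'I_N -> {mfun T >-> E}) :=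
  isMeasurableFun.Build _ _ _ _ (sample_tuple Z) (measurable_sample_tuple Z).

(** One product formula encodes both independence and the common law: setting some [A i] to the
    whole space gives every subfamily and every marginal. *)
Definition iid_law dT (T : measurableType dT) (P : probability T R) N
    (Z : 'I_N -> {mfun T >-> E}) (mu : probability E R) :=
  forall A : 'I_N -> set E, (forall i, measurable (A i)) ->
    P [set w | forall i, A i (Z i w)] = (\prod_i mu (A i))%E.

(** The two probability spaces may differ. This allows a sample to be compared with a permuted copy
    of itself, and with a resampled copy living on a product space. *)
Lemma iid_law_unique dT1 (T1 : measurableType dT1) (P1 : probability T1 R)
    dT2 (T2 : measurableType dT2) (P2 : probability T2 R) N
    (Z1 : 'I_N -> {mfun T1 >-> E}) (Z2 : 'I_N -> {mfun T2 >-> E}) mu :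
  iid_law P1 Z1 mu -> iid_law P2 Z2 mu ->
  forall B, measurable B ->
    P1 (sample_tuple Z1 @^-1` B) = P2 (sample_tuple Z2 @^-1` B).
Proof.
move=> iid1 iid2 B mB.
apply: (tuple_measure_unique (m1 := distribution P1 (sample_tuple Z1))
  (m2 := distribution P2 (sample_tuple Z2))) => //.
  by rewrite /= /distribution /pushforward preimage_setT probability_setT ltry.
move=> A mA; rewrite /distribution /pushforward /=.
rewrite [LHS](_ : _ = P1 [set w | forall i, A i (Z1 i w)]); last first.
  by congr (P1 _); apply/seteqP; split => w /= Aw i; move: (Aw i); rewrite tnth_mktuple.
rewrite [RHS](_ : _ = P2 [set w | forall i, A i (Z2 i w)]); last first.
  by congr (P2 _); apply/seteqP; split => w /= Aw i; move: (Aw i); rewrite tnth_mktuple.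
by rewrite iid1// iid2.
Qed.

(** Exchangeability: the product of the [mu (A i)] is invariant under reindexing. *)
Lemma iid_law_perm dT (T : measurableType dT) (P : probability T R) N
    (Z : 'I_N -> {mfun T >-> E}) mu (s : 'S_N) :
  iid_law P Z mu -> iid_law P (fun i => Z (s i)) mu.
Proof.
move=> iidZ A mA; rewrite (reindex_inj (@perm_inj _ s^-1%g))/=.
rewrite -iidZ//; congr (P _); apply/seteqP; split => w /= Aw i.
  by move: (Aw (s^-1%g i)); rewrite permKV.
by move: (Aw (s i)); rewrite permK.
Qed.

Section resample.
Context dT (T : measurableType dT) (P : probability T R) N
  (Z : 'I_N -> {mfun T >-> E}) (mu : probability E R) (i0 : 'I_N).

(* The sample with its [i0]-th point replaced by a fresh draw from [mu]. *)
Definition resample (i : 'I_N) (p : T * E) : E :=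
  if i == i0 then p.2 else Z i p.1.

Lemma measurable_resample i : measurable_fun setT (resample i).
Proof.
rewrite /resample; case: eqP => _; first exact: measurable_snd.
exact: (measurableT_comp (measurable_funP (Z i)) measurable_fst).
Qed.

HB.instance Definition _ i :=
  isMeasurableFun.Build _ _ _ _ (resample i) (measurable_resample i).

Lemma iid_law_resample : iid_law P Z mu -> iid_law (P \x mu)%E resample mu.
Proof.
move=> iidZ A mA.
(* The resampled family ignores [Z i0], so the constraint at [i0] is lifted from the old sample and
   carried by the fresh draw alone. The event becomes a product set. *)
pose A' i := if i == i0 then setT else A i.
have mA' i : measurable (A' i) by rewrite /A'; case: ifP.
have mrect : measurable [set w | forall i, A' i (Z i w)].
  rewrite (_ : [set _ | _] = \bigcap_(i in setT) (Z i @^-1` A' i)); last first.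
    by apply/seteqP; split => w /= Aw i => [_|]; exact: Aw.
  apply: fin_bigcap_measurable => // i _.
  by rewrite -[X in measurable X]setTI; exact: measurable_funP.
rewrite (_ : [set _ | _] = [set w | forall i, A' i (Z i w)] `*` A i0).
  rewrite [LHS](product_measure1E P mu mrect (mA i0)).
  rewrite [X in (X * _)%E](iidZ _ mA') (bigD1 i0)//= [RHS](bigD1 i0)//= muleC.
  rewrite {1}/A' eqxx probability_setT mul1e; congr (_ * _)%E.
  by apply: eq_bigr => i /negbTE ii0; rewrite /A' ii0.
apply/seteqP; split => [[w x]/= Awx|[w x]/= [Aw Ax] i].
  split; last by move: (Awx i0); rewrite /resample eqxx.
  by move=> i; move: (Awx i); rewrite /A' /resample; case: eqP.
by move: (Aw i); rewrite /A' /resample; case: eqP => [->|].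
Qed.

End resample.
End joint_law.

(** A rectangle event for the pooled sample is an event of the [X] sample intersected with one of
    the [Y] sample. Independence of the samples splits the probability, and independence within each
    sample finishes. *)
Lemma two_sample_model_iid_law (R : realType) dE (E : measurableType dE)
    dT (T : measurableType dT) (P : probability T R) m n
    (X : 'I_m -> {RV P >-> E}) (Y : 'I_n -> {RV P >-> E})
    (mu : probability E R) : two_sample_model X Y mu mu ->
  iid_law P
    (fun i => match fintype.split i with inl j => X j | inr k => Y k end) mu.
Proof.
move=> [[Xmu Xindep] [Ymu Yindep] XY] A mA.
have g_sigma_preimage_bigcap k (Z : 'I_k -> {RV P >-> E}) (B : 'I_k -> set E) :
    (forall i, measurable (B i)) ->
    g_sigma_preimage (fun i => Z i : T -> E)
      (\bigcap_(i in [set i | i \in [set: 'I_k]%SET]) (Z i @^-1` B i)).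
  move=> mB; pose G := \big[setU/set0]_(i < k)
    preimage_set_system setT (Z i : T -> E) measurable.
  change (@measurable _ (g_sigma_algebraType G)
    (\bigcap_(i in [set i | i \in [set: 'I_k]%SET]) (Z i @^-1` B i))).
  apply: fin_bigcap_measurable => // i _; apply: sub_sigma_algebra.
  rewrite /G -bigcup_seq; exists i => /=; first by rewrite mem_index_enum.
  by exists (B i) => //; rewrite setTI.
rewrite big_split_ord/=.
under eq_bigr => j _ do rewrite -(Xmu j)//.
under [X in (_ * X)%E]eq_bigr => j _ do rewrite -(Ymu j)//.
rewrite (_ : [set _ | _] =
  (\bigcap_(i in [set i | i \in [set: 'I_m]%SET]) (X i @^-1` A (lshift n i)))
  `&`
  (\bigcap_(i in [set i | i \in [set: 'I_n]%SET]) (Y i @^-1` A (rshift m i)))).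
  rewrite XY; [|exact: g_sigma_preimage_bigcap|exact: g_sigma_preimage_bigcap].
  rewrite Xindep// Yindep//.
  by congr (_ * _)%E; apply: eq_bigl => i; rewrite finset.in_setT.
apply/seteqP; split => w /=.
  move=> Aw; split => i _ /=.
    by move: (Aw (lshift n i)); rewrite (unsplitK (inl _ i)).
  by move: (Aw (rshift m i)); rewrite (unsplitK (inr _ i)).
move=> [AX AY] i; case: (splitP i) => [j|k] ij.
  have -> : i = lshift n j by exact: val_inj.
  by apply: AX; rewrite /= finset.in_setT.
have -> : i = rshift m k by exact: val_inj.
by apply: AY; rewrite /= finset.in_setT.
Qed.

(** * Assignment costs and their unique minimisers *)

Section assignment.
Context (R : realType) (d m n : nat).
Implicit Types (h z : 'I_(m + n) -> 'rV[R]_d) (s t : 'S_(m + n)).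

(** Expand the squares: since [s] only reorders the vectors of [h], their squared norms sum to a
    constant, and [s] survives in the cross term alone. *)
Lemma assignment_costE h z s : assignment_cost h z s =
  \sum_i euclidean_sqnorm (z i) + \sum_i euclidean_sqnorm (h i) -
  (\sum_i \sum_k h (s i) ord0 k * z i ord0 k) *+ 2.
Proof.
rewrite [in X in _ + X - _](reindex_inj (@perm_inj _ s))/= -big_split/=.
rewrite -sumrMnl -sumrB; apply: eq_bigr => i _.
transitivity (\sum_k (z i ord0 k ^+ 2 + h (s i) ord0 k ^+ 2 -
    (h (s i) ord0 k * z i ord0 k) *+ 2)).
  rewrite /euclidean_sqnorm; apply: eq_bigr => k _; rewrite !mxE sqrrB.
  by rewrite addrAC [in X in _ - X *+ 2]mulrC.
by rewrite sumrB sumrMnl big_split.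
Qed.

Lemma assignment_cost_tie h z s t :
  assignment_cost h z s = assignment_cost h z t ->
  \sum_i \sum_k (h (s i) - h (t i)) ord0 k * z i ord0 k = 0.
Proof.
rewrite !assignment_costE => /addrI/oppr_inj/eqP; rewrite -subr_eq0 -mulrnBl.
rewrite mulrn_eq0/= -sumrB => /eqP e; rewrite -[RHS]e; apply: eq_bigr => i _.
by rewrite -sumrB; apply: eq_bigr => k _; rewrite !mxE mulrBl.
Qed.

Lemma assignment_cost_permute h z s t :
  assignment_cost h (fun i => z (s i)) t = assignment_cost h z (s^-1 * t)%g.
Proof.
rewrite /assignment_cost [RHS](reindex_inj (@perm_inj _ s))/=.
by apply: eq_bigr => i _; rewrite permM permK.
Qed.

Lemma measurable_assignment_cost h s : measurable_fun setT
  (fun z : (m + n).-tuple 'rV[R]_d => assignment_cost h (tnth z) s).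
Proof.
rewrite (_ : (fun _ => _) = fun z : (m + n).-tuple 'rV[R]_d =>
    \sum_i \sum_k (row_coord k (tnth z i) - h (s i) ord0 k) ^+ 2); last first.
  apply/funext => z; apply: eq_bigr => i _; apply: eq_bigr => k _.
  by rewrite !mxE.
apply: measurable_sum => i; apply: measurable_sum => k.
apply: measurable_funX; apply: measurable_funB; last exact: measurable_cst.
apply: (measurableT_comp (@measurable_row_coord R d k)).
exact: measurable_tnth.
Qed.

(** Strict inequality makes these sets Borel and pairwise disjoint in [s]; ties fall outside all of
    them. *)
Definition strictly_optimal h s : set ((m + n).-tuple 'rV[R]_d) :=
  [set z | forall t, t != s ->
    assignment_cost h (tnth z) s < assignment_cost h (tnth z) t].

Lemma measurable_strictly_optimal h s : measurable (strictly_optimal h s).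
Proof.
rewrite (_ : strictly_optimal h s = \bigcap_(t in [set t | t != s])
  ((fun z : (m + n).-tuple _ =>
      assignment_cost h (tnth z) s < assignment_cost h (tnth z) t)
    @^-1` [set true])); last first.
  by apply/seteqP; split.
apply: fin_bigcap_measurable => [|t _]; first exact: finite_finset.
rewrite -[X in measurable X]setTI.
by apply: measurable_fun_ltr => //; exact: measurable_assignment_cost.
Qed.

Lemma trivIset_strictly_optimal h : trivIset setT (strictly_optimal h).
Proof.
apply/trivIsetP => s t _ _ st; rewrite -subset0 => z [/= zs zt].
have ts : t != s by rewrite eq_sym.
by have := lt_trans (zs t ts) (zt s st); rewrite ltxx.
Qed.

Lemma optimal_assignment_eq h (z : (m + n).-tuple 'rV[R]_d) s t :
  strictly_optimal h s z -> optimal_assignment h (tnth z) t -> t = s.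
Proof.
by move=> zs zt; apply: contrapT => /eqP /zs; rewrite ltNge zt.
Qed.

(** The cost of [t] on [z'] is the cost of [s * t] on [z], and left multiplication by [s] is a
    bijection of the symmetric group taking [1] to [s]. *)
Lemma strictly_optimal_permute h s (z z' : (m + n).-tuple 'rV[R]_d) :
  (forall i, tnth z' i = tnth z ((s^-1)%g i)) ->
  strictly_optimal h s z <-> strictly_optimal h 1%g z'.
Proof.
move=> /funext zz'; rewrite /strictly_optimal/= zz'.
split=> opt t.
  rewrite !assignment_cost_permute invgK mulg1 => t1; apply: opt.
  by apply: contraNneq t1 => /(congr1 (mulg s^-1)%g); rewrite mulKg mulVg => ->.
move=> ts; have := opt (s^-1 * t)%g; rewrite !assignment_cost_permute invgK mulg1.
rewrite mulKVg; apply; apply: contraNneq ts => /(congr1 (mulg s)).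
by rewrite mulKVg mulg1 => ->.
Qed.

Lemma strictly_optimal_or_tie h (z : (m + n).-tuple 'rV[R]_d) :
  (exists s, strictly_optimal h s z) \/
  exists s t, s != t /\
    assignment_cost h (tnth z) s = assignment_cost h (tnth z) t.
Proof.
case: (@Order.TotalTheory.arg_minP _ _ _ (1%g : 'S_(m + n)) xpredT
  (assignment_cost h (tnth z))) => // s _ smin.
have [[t [st ?]]|tie] := pselect (exists t, s != t /\
    assignment_cost h (tnth z) s = assignment_cost h (tnth z) t).
  by right; exists s, t.
left; exists s => t ts; rewrite lt_neqAle smin// andbT.
by apply/eqP => e; apply: tie; exists t; rewrite eq_sym.
Qed.

End assignment.

(** * Almost sure uniqueness and uniformity of the optimal permutation *)

Section iid_rows.
Context (R : realType) (d : nat) dT (T : measurableType dT)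
  (P : probability T R) (mu : probability 'rV[R]_d R).
Hypothesis mu_ac : mu `<< lebesgue_row R d.

Lemma iid_hyperplane_null N (Z : 'I_N -> {RV P >-> 'rV[R]_d})
    (u : 'I_N -> 'rV[R]_d) (i0 : 'I_N) : iid_law P Z mu -> u i0 != 0 ->
  P [set w | \sum_i \sum_k u i ord0 k * Z i w ord0 k = 0] = 0%E.
Proof.
(* Resampling the point [i0] does not change the law of the sample, so that by
   Fubini it suffices that [mu] charges no hyperplane of R^d. *)
move=> iidZ ui0.
pose H := [set z : N.-tuple 'rV[R]_d |
  \sum_i \sum_k u i ord0 k * tnth z i ord0 k = 0].
have mf : measurable_fun setT (fun z : N.-tuple 'rV[R]_d =>
    \sum_i \sum_k u i ord0 k * tnth z i ord0 k).
  apply: measurable_sum => i; apply: measurable_sum => k.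
  apply: measurable_funM; first exact: measurable_cst.
  apply: (measurableT_comp (@measurable_row_coord R d k)).
  exact: measurable_tnth.
have mH : measurable H.
  by rewrite -[X in measurable X]setTI; exact: (mf measurableT [set 0]).
rewrite (_ : [set _ | _] = sample_tuple Z @^-1` H); last first.
  apply/seteqP; split => w /=; rewrite /H/= => e; rewrite -[RHS]e;
    by apply: eq_bigr => i _; apply: eq_bigr => k _; rewrite tnth_mktuple.
rewrite (iid_law_unique iidZ (iid_law_resample i0 iidZ) mH).
change (\int[P]_w (mu \o xsection (sample_tuple (resample Z i0) @^-1` H)) w = 0)%E.
rewrite integral0_eq// => w _ /=.
(* With [w] fixed, the terms other than [i0] are constants moved to the right-hand side; the section
   is a hyperplane of R^d with normal [u i0]. *)
pose c := - \sum_(i | i != i0) \sum_k u i ord0 k * Z i w ord0 k.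
rewrite (_ : xsection _ w = [set x : 'rV[R]_d | \sum_k u i0 ord0 k * x ord0 k = c]).
  have /null_content_dominatesP := mu_ac; apply.
    exact: measurable_hyperplane.
  exact: lebesgue_row_hyperplane.
have sumE x : \sum_i \sum_k u i ord0 k *
    tnth (sample_tuple (resample Z i0) (w, x)) i ord0 k =
    \sum_k u i0 ord0 k * x ord0 k - c.
  rewrite (bigD1 i0)//= tnth_mktuple/= {1}/resample eqxx/=; congr (_ + _).
  rewrite opprK; apply: eq_bigr => i ii0; apply: eq_bigr => k _.
  by rewrite tnth_mktuple/= /resample (negbTE ii0).
rewrite xsectionE; apply/seteqP; split => x; rewrite /H/= sumE.
  by move=> /eqP; rewrite subr_eq0 => /eqP.
by move=> ->; rewrite subrr.
Qed.

Context (m n : nat) (Z : 'I_(m + n) -> {RV P >-> 'rV[R]_d})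
  (h : 'I_(m + n) -> 'rV[R]_d).
Hypotheses (h_inj : injective h) (iidZ : iid_law P Z mu).

Let V s := sample_tuple Z @^-1` strictly_optimal h s.

Lemma measurable_strictly_optimal_event s : measurable (V s).
Proof.
rewrite -[X in measurable X]setTI.
by apply: measurable_sample_tuple => //; exact: measurable_strictly_optimal.
Qed.

(** Off the union two distinct permutations tie, so the complement is covered by finitely many
    events [tie p]. Each is null because injectivity of [h] yields an index with a nonzero
    coefficient. *)
Lemma strictly_optimal_ae : P (\bigcup_s V s) = 1%E.
Proof.
have mUV : measurable (\bigcup_s V s).
  apply: fin_bigcup_measurable => [|s _]; first exact: finite_finset.
  exact: measurable_strictly_optimal_event.
pose tie (p : 'S_(m + n) * 'S_(m + n)) := [set w |
  \sum_i \sum_k (h (p.1 i) - h (p.2 i)) ord0 k * Z i w ord0 k = 0].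
have mtie p : measurable (tie p).
  rewrite -[X in measurable X]setTI.
  have mf : measurable_fun setT (fun w =>
      \sum_i \sum_k (h (p.1 i) - h (p.2 i)) ord0 k * Z i w ord0 k).
    apply: measurable_sum => i; apply: measurable_sum => k.
    apply: measurable_funM; first exact: measurable_cst.
    apply: (measurableT_comp (@measurable_row_coord R d k)).
    exact: measurable_funP.
  exact: (mf measurableT [set 0]).
have UV0 : P (~` \bigcup_s V s) = 0%E.
  apply/eqP; rewrite -measure_le0.
  apply: (le_trans (content_sub_fsum P (D := [set p | p.1 != p.2])
    (A_ := tie) _ _ _ _)) => //.
  - exact: finite_finset.
  - exact: measurableC.
  - move=> w /= VNw.
    have [[s sw]|[s [t [st tst]]]] := strictly_optimal_or_tie h (sample_tuple Z w).
      by exfalso; apply: VNw; exists s.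
    exists (s, t) => //; rewrite /tie/= -[RHS](assignment_cost_tie tst).
    by apply: eq_bigr => i _; apply: eq_bigr => k _; rewrite tnth_mktuple.
  - rewrite fsbig1// => -[s t] /= st.
    have [i sti] : exists i, s i != t i.
      apply/existsP; rewrite -negb_forall; apply: contra st => /forallP st.
      by apply/eqP/permP => i; apply/eqP; exact: st.
    apply: (iid_hyperplane_null (i0 := i)) => //.
    by rewrite subr_eq0 (inj_eq h_inj).
by rewrite -[X in P X]setCK probability_setC ?UV0 ?sube0//; exact: measurableC.
Qed.

(** Reordering the sample by [s^-1] turns [V s] into [V 1] and preserves the joint law. *)
Lemma strictly_optimal_uniform s : P (V s) = P (V 1%g).
Proof.
rewrite /V -(iid_law_unique (iid_law_perm s^-1%g iidZ) iidZ
  (measurable_strictly_optimal h 1%g)).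
congr (P _); apply/seteqP; split => w /=; apply strictly_optimal_permute => i;
  by rewrite !tnth_mktuple.
Qed.

(** The [V s] are disjoint and cover almost everything, so any event can be computed by cases on the
    optimal permutation. *)
Lemma measure_strictly_optimal_split S : measurable S ->
  P S = (\sum_s P (S `&` V s))%E.
Proof.
move=> mS.
have mUV : measurable (\bigcup_s V s).
  apply: fin_bigcup_measurable => [|s _]; first exact: finite_finset.
  exact: measurable_strictly_optimal_event.
have UV0 : P (~` \bigcup_s V s) = 0%E.
  by rewrite probability_setC// strictly_optimal_ae subee.
have mSV s : measurable (S `&` V s).
  by apply: measurableI => //; exact: measurable_strictly_optimal_event.
rewrite -[S in LHS]setIT -(setUv (\bigcup_s V s)) setIUr measureU0; first last.
- apply: (subset_measure0 (B := ~` \bigcup_s V s)) => //.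
    by apply: measurableI => //; exact: measurableC.
  exact: measurableC.
- by apply: measurableI => //; exact: measurableC.
- exact: measurableI.
rewrite setI_bigcupr measure_fin_bigcup//; first last.
- apply: trivIset_setIl; apply/trivIsetP => s t _ _ st; rewrite /V -preimage_setI.
  have /trivIsetP/(_ s t I I st) -> := trivIset_strictly_optimal (h := h).
  by rewrite preimage_set0.
- exact: finite_finset.
rewrite (_ : setT = [set` enum {: 'S_(m + n)}]).
  by rewrite -fsbig_seq ?enum_uniq// big_enum.
by apply/seteqP; split => s //= _; rewrite mem_enum.
Qed.

End iid_rows.

(** * Law of the statistic *)

(** [mnormalize] falls back on [P] when the total mass is zero or infinite; a finite nonzero [c]
    rules this out. *)
Lemma mnormalizeE d (T : measurableType d) (R : realType)
    (mu : {measure set T -> \bar R}) (P : probability T R) (c : R) A :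
  mu setT = c%:E -> c != 0 -> mnormalize mu P A = (mu A * c^-1%:E)%E.
Proof. by move=> muT c0; rewrite /mnormalize muT eqe (negbTE c0). Qed.

(** This is the image under [f] of the uniform law on [I], built by normalising a sum of Dirac
    masses. The element [i0] makes [I] nonempty, so the total mass [#|I|] is nonzero. *)
Lemma uniform_law_exists (R : realType) (I : finType) (i0 : I) (f : I -> R) :
  exists Q : probability R R, forall A, measurable A ->
    Q A = (#|I|%:R^-1%:E * \sum_(i : I) \d_(f i) A)%E.
Proof.
pose D := msum (fun k => \d_(f (nth i0 (enum I) k)) : {measure set R -> \bar R}) #|I|.
have DE A : D A = (\sum_(i : I) \d_(f i) A)%E.
  rewrite /D /msum -[in RHS]big_enum/= (big_nth i0) -cardE big_mkord.
  by apply: eq_bigr.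
have DT : D setT = #|I|%:R%:E.
  rewrite DE; under eq_bigr do rewrite diracT.
  by rewrite sumEFin sumr_const.
have I0 : #|I|%:R != 0 :> R by rewrite pnatr_eq0 -lt0n; apply/card_gt0P; exists i0.
exists (mnormalize D (\d_(0 : R))) => A mA.
by rewrite [LHS](mnormalizeE (mu := D) _ _ DT I0) [X in (X * _)%E]DE muleC.
Qed.

(** Universality lies in the order of quantifiers: [Q] is fixed before [mu], the probability space
    and the samples. The map [sigma] is an arbitrary pointwise choice of minimiser. *)
Theorem proposition3p1 (R : realType) (d m n : nat)
    (m_gt0 : (1 <= m)%N) (n_gt0 : (1 <= n)%N)
    (nu : probability 'rV[R]_d R) (nu_ac : nu `<< lebesgue_row R d)
    (J : 'rV[R]_d -> 'rV[R]_d) (J_inj : injective J)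
    (J_cont : {ae lebesgue_row R d, forall x, continuous_at x J})
    (erd_finite : finite_second_moments (effective_reference nu J))
    (erd_posdef :
      positive_definite (covariance_matrix (effective_reference nu J)))
    (h : 'I_(m + n) -> 'rV[R]_d) (h_inj : injective h) :
  exists Q : probability R R,
    forall (mu : probability 'rV[R]_d R), mu `<< lebesgue_row R d ->
    forall (dT : measure_display) (T : measurableType dT) (P : probability T R)
      (X : 'I_m -> {RV P >-> 'rV[R]_d}) (Y : 'I_n -> {RV P >-> 'rV[R]_d})
      (sigma : T -> 'S_(m + n)) (stat : {RV P >-> R}),
      two_sample_model X Y mu mu ->
      (forall w, optimal_assignment h
                   (pooled (fun i => X i w) (fun j => Y j w)) (sigma w)) ->
      (forall w, stat w = rank_hotelling nu J h (sigma w)) ->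
      forall A : set R, measurable A -> distribution P stat A = Q A.
Proof.
have [Q QE] := uniform_law_exists (1%g : 'S_(m + n))
  (fun s => rank_hotelling nu J h s).
exists Q => mu mu_ac dT T P X Y sigma stat XY sigma_opt statE A mA.
pose Z i : {RV P >-> 'rV[R]_d} :=
  match fintype.split i with inl j => X j | inr k => Y k end.
have iidZ : iid_law P Z mu := two_sample_model_iid_law XY.
pose V s := sample_tuple Z @^-1` strictly_optimal h s.
(* On [V s] every choice of minimiser returns [s], so the rule for breaking ties acts only on a null
   set. *)
have sigmaE s w : V s w -> sigma w = s.
  move=> Vsw; apply: (optimal_assignment_eq Vsw).
  rewrite (_ : tnth _ = pooled (fun i => X i w) (fun j => Y j w)) //.
  by apply/funext => i; rewrite tnth_mktuple /Z /pooled; case: fintype.split.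
(* The statistic is constant on [V s], so the event meets [V s] in all of it or in nothing. *)
have statV s B : stat @^-1` B `&` V s =
    if rank_hotelling nu J h s \in B then V s else set0.
  apply/seteqP; split => w /=.
    by move=> [Bw Vw]; move: Bw; rewrite statE (sigmaE s w Vw) => /mem_set ->.
  case: ifPn => // /set_mem Bs Vw; split => //.
  by rewrite statE (sigmaE s w Vw).
have split_law B : measurable B ->
    P (stat @^-1` B) =
      (P (V 1%g) * \sum_(s : 'S_(m + n)) \d_(rank_hotelling nu J h s) B)%E.
  move=> mB; have mS : measurable (stat @^-1` B).
    by rewrite -[X in measurable X]setTI; exact: measurable_funP.
  rewrite (measure_strictly_optimal_split mu_ac h_inj iidZ mS).
  rewrite ge0_sume_distrr//; apply: eq_bigr => s _.
  rewrite -/(V s) statV diracE; case: ifPn => _; last by rewrite measure0 mule0.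
  by rewrite mule1 (strictly_optimal_uniform h iidZ).
rewrite QE// [LHS]split_law//; congr (_ * _)%E.
(* Taking the whole space for [B] makes every Dirac mass 1, which forces [P (V 1)] to be the inverse
   of the number of permutations. *)
have := split_law setT measurableT.
rewrite preimage_setT probability_setT; under eq_bigr do rewrite diracT.
rewrite sumEFin sumr_const.
have /fineK <- : P (V 1%g) \is a fin_num.
  by apply: fin_num_measure; exact: measurable_strictly_optimal_event.
have S0 : #|{: 'S_(m + n)}|%:R != 0 :> R.
  by rewrite pnatr_eq0 -lt0n; apply/card_gt0P; exists 1%g.
rewrite -EFinM => -[pS]; congr _%:E.
by apply: (mulIf S0); rewrite mulVf// -pS.
Qed.
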